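(* Let $\mathfrak{vir}(S^1)\ltimes\mathfrak{vir}(S^1)$ be the self-semidirect product of the Virasoro algebra $\mathfrak{vir}(S^1)=\operatorname{Vect}(S^1)\oplus\mathbb{R}$, let $\ell(u,a,v,b)$ be a Lagrangian on it, and let $(m,l,n,o)=\left(\frac{\delta\ell}{\delta u},\frac{\delta\ell}{\delta a},\frac{\delta\ell}{\delta v},\frac{\delta\ell}{\delta b}\right)$. Then the Euler–Poincaré equations for $\ell$ are $$\partial_t m+(um)_x+u_xm+l\,u_{xxx}+(vn)_x+v_xn+o\,v_{xxx}=0,\qquad \partial_t l=0,$$ $$\partial_t n+((u+v)n)_x+(u+v)_xn+o\,(u+v)_{xxx}=0,\qquad \partial_t o=0.$$ Moreover, with $D=m-n$ and $E=l-o$, these equations imply $$\partial_t D+(uD)_x+u_xD+E\,u_{xxx}=0,\qquad \partial_t n+((u+v)n)_x+(u+v)_xn+o\,(u+v)_{xxx}=0 .$$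
   Context: All functions are smooth on the circle $S^1$, and subscript $x$ denotes the spatial derivative. $\operatorname{Vect}(S^1)$ is the space of smooth vector fields $u\,\partial_x$ on $S^1$, identified with functions $u$, with adjoint action equal to the negative commutator of vector fields: $\operatorname{ad}_u v=-(uv_x-vu_x)$. The Virasoro algebra is $\operatorname{Vect}(S^1)\oplus\mathbb{R}$ with $\operatorname{ad}_{(u,a)}(v,b)=(\operatorname{ad}_uv,\sigma(u,v))$, where $\sigma(u,v)=\int_{S^1}u_xv_{xx}\,dx$ is the Gelfand–Fuchs 2-cocycle. For a Lie algebra $\mathfrak{a}$, the self-semidirect product $\mathfrak{a}\ltimes\mathfrak{a}$ is $\mathfrak{a}\times\mathfrak{a}$ with $$\operatorname{ad}_{(X,Y)}(Z,W)=\big(\operatorname{ad}_X Z,\ \operatorname{ad}_{X+Y}(Z+W)-\operatorname{ad}_X Z\big).$$ Elements of $\mathfrak{vir}(S^1)\ltimes\mathfrak{vir}(S^1)$ are written $(u,a,v,b)=((u,a),(v,b))$. The (smooth) dual consists of $(m,l,n,o)$ with $m,n$ smooth functions (representing $m\,dx\otimes dx$, $n\,dx\otimes dx$) and $l,o\in\mathbb{R}$, paired by $$\langle(m,l,n,o),(u,a,v,b)\rangle=\int_{S^1}(mu+nv)\,dx+la+ob .$$ Variational derivatives of $\ell$ are taken with respect to this pairing and assumed to exist as smooth elements. The coadjoint operator is defined by $\langle\operatorname{ad}^*_\zeta\mu,\eta\rangle=\langle\mu,\operatorname{ad}_\zeta\eta\rangle$, and the Euler–Poincaré equation is $\frac{d}{dt}\mu+\operatorname{ad}^*_\zeta\mu=0$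 for a smooth curve $\zeta(t)=(u,a,v,b)$ with $\mu=\frac{\delta\ell}{\delta\zeta}=(m,l,n,o)$. *)

(* Defs.v *)
From Stdlib Require Import Reals Lra Lia ProofIrrelevance FunctionalExtensionality.
From Coquelicot Require Import Coquelicot.
Open Scope R_scope.

(** ** Smooth functions on the circle R / LZ, as smooth L-periodic functions on R *)

Definition smooth (f : R -> R) : Prop := forall n x, ex_derive_n f n x.

Record circle_fun (L : R) : Type := CircleFun {
  cf_fun :> R -> R;
  cf_smooth : smooth cf_fun;
  cf_periodic : forall x, cf_fun (x + L) = cf_fun x }.

Arguments CircleFun {L} _ _ _.
Arguments cf_fun {L} _ _.
Arguments cf_smooth {L} _ _ _.
Arguments cf_periodic {L} _ _.

Lemma circle_fun_eq L (f g : circle_fun L) : (forall x, f x = g x) -> f = g.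
Proof.
destruct f as [f hf pf]; destruct g as [g hg pg]; simpl; intros E.
assert (f = g) by (apply functional_extensionality; exact E); subst g.
f_equal; apply proof_irrelevance.
Qed.

Lemma smooth_ex_derive f x : smooth f -> ex_derive f x.
Proof. intros hf; exact (hf 1%nat x). Qed.

Lemma smooth_Derive f : smooth f -> smooth (Derive f).
Proof.
intros hf [|n] x; [exact I|].
generalize (hf (S (S n)) x); simpl; apply ex_derive_ext; intros y.
change (Derive_n f (S n) y = Derive_n (Derive_n f 1) n y).
rewrite Derive_n_comp; f_equal; lia.
Qed.

Lemma smooth_of_Derive f :
  (forall x, ex_derive f x) -> smooth (Derive f) -> smooth f.
Proof.
intros h0 h1 [|[|n]] x; [exact I|exact (h0 x)|].
generalize (h1 (S n) x); simpl; apply ex_derive_ext; intros y.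
change (Derive_n (Derive_n f 1) n y = Derive_n f (S n) y).
rewrite Derive_n_comp; f_equal; lia.
Qed.

Lemma smooth_plus f g : smooth f -> smooth g -> smooth (fun x => f x + g x).
Proof.
intros hf hg n x; apply ex_derive_n_plus;
  apply filter_forall; intros y k _; [apply hf|apply hg].
Qed.

Lemma smooth_scal c f : smooth f -> smooth (fun x => c * f x).
Proof. intros hf n x; apply ex_derive_n_scal_l, hf. Qed.

Lemma smooth_mult f g : smooth f -> smooth g -> smooth (fun x => f x * g x).
Proof.
intros hf hg n; revert f g hf hg.
induction n as [n IH] using (well_founded_induction Wf_nat.lt_wf).
intros f g hf hg x; destruct n as [|[|n]]; [exact I| |].
{ exact (ex_derive_mult f g x (smooth_ex_derive _ _ hf) (smooth_ex_derive _ _ hg)). }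
assert (H : ex_derive_n (Derive (fun x => f x * g x)) (S n) x).
{ apply ex_derive_n_ext with (fun y => Derive f y * g y + f y * Derive g y).
  { intros y; symmetry; apply Derive_mult; apply smooth_ex_derive; assumption. }
  apply ex_derive_n_plus; apply filter_forall; intros y k Hk;
    apply IH; try lia; auto using smooth_Derive. }
revert H; simpl; apply ex_derive_ext; intros y.
change (Derive_n (Derive_n (fun x => f x * g x) 1) n y
        = Derive_n (fun x => f x * g x) (S n) y).
rewrite Derive_n_comp; f_equal; lia.
Qed.

Lemma Derive_periodic L f :
  (forall x, f (x + L) = f x) -> forall x, Derive f (x + L) = Derive f x.
Proof.
intros pf x; unfold Derive; f_equal; apply Lim_ext; intros h.
replace (x + L + h) with (x + h + L) by ring; now rewrite !pf.
Qed.

Section CircleFunOps.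
Variable L : R.
Implicit Types f g : circle_fun L.

Definition cf_plus f g : circle_fun L.
Proof.
refine (CircleFun (fun x => f x + g x)
          (smooth_plus _ _ (cf_smooth f) (cf_smooth g)) _).
abstract (intros x; now rewrite !cf_periodic).
Defined.

Definition cf_scal (c : R) f : circle_fun L.
Proof.
refine (CircleFun (fun x => c * f x) (smooth_scal c _ (cf_smooth f)) _).
abstract (intros x; now rewrite !cf_periodic).
Defined.

Definition cf_mult f g : circle_fun L.
Proof.
refine (CircleFun (fun x => f x * g x)
          (smooth_mult _ _ (cf_smooth f) (cf_smooth g)) _).
abstract (intros x; now rewrite !cf_periodic).
Defined.

Definition cf_deriv f : circle_fun L :=
  CircleFun (Derive f) (smooth_Derive _ (cf_smooth f))
    (Derive_periodic L f (cf_periodic f)).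

Definition cf_zero : circle_fun L :=
  CircleFun (fun _ => 0) (ex_derive_n_const 0) (fun _ => eq_refl).

Definition cf_opp f : circle_fun L := cf_scal (-1) f.

Lemma cf_plus_comm f g : cf_plus f g = cf_plus g f.
Proof. apply circle_fun_eq; intros x; simpl; ring. Qed.

Lemma cf_plus_assoc f g h : cf_plus f (cf_plus g h) = cf_plus (cf_plus f g) h.
Proof. apply circle_fun_eq; intros x; simpl; ring. Qed.

Lemma cf_plus_zero_r f : cf_plus f cf_zero = f.
Proof. apply circle_fun_eq; intros x; simpl; ring. Qed.

Lemma cf_plus_opp_r f : cf_plus f (cf_opp f) = cf_zero.
Proof. apply circle_fun_eq; intros x; simpl; ring. Qed.

Definition cf_AbelianMonoid_mixin :=
  AbelianMonoid.Mixin _ cf_plus cf_zero cf_plus_comm cf_plus_assoc cf_plus_zero_r.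

Canonical cf_AbelianMonoid :=
  AbelianMonoid.Pack (circle_fun L) cf_AbelianMonoid_mixin (circle_fun L).

Definition cf_AbelianGroup_mixin :=
  AbelianGroup.Mixin cf_AbelianMonoid cf_opp cf_plus_opp_r.

Canonical cf_AbelianGroup :=
  AbelianGroup.Pack (circle_fun L)
    (AbelianGroup.Class _ _ cf_AbelianGroup_mixin) (circle_fun L).

Lemma cf_scal_assoc (x y : R_AbsRing) f :
  cf_scal x (cf_scal y f) = cf_scal (mult x y) f.
Proof. apply circle_fun_eq; intros z; unfold mult; simpl; ring. Qed.

Lemma cf_scal_one f : cf_scal (one : R_AbsRing) f = f.
Proof. apply circle_fun_eq; intros z; unfold one; simpl; ring. Qed.

Lemma cf_scal_plus_l (x : R_AbsRing) f g :
  cf_scal x (plus f g) = plus (cf_scal x f) (cf_scal x g).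
Proof. apply circle_fun_eq; intros z; simpl; ring. Qed.

Lemma cf_scal_plus_r (x y : R_AbsRing) f :
  cf_scal (plus x y) f = plus (cf_scal x f) (cf_scal y f).
Proof. apply circle_fun_eq; intros z; unfold plus; simpl; ring. Qed.

Definition cf_ModuleSpace_mixin :=
  ModuleSpace.Mixin R_AbsRing cf_AbelianGroup cf_scal
    cf_scal_assoc cf_scal_one cf_scal_plus_l cf_scal_plus_r.

Canonical cf_ModuleSpace :=
  ModuleSpace.Pack R_AbsRing (circle_fun L)
    (ModuleSpace.Class _ _ _ cf_ModuleSpace_mixin) (circle_fun L).

End CircleFunOps.

Arguments cf_plus {L} _ _.
Arguments cf_scal {L} _ _.
Arguments cf_mult {L} _ _.
Arguments cf_deriv {L} _.
Arguments cf_opp {L} _.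

(** ** The Virasoro algebra and its self-semidirect product *)

Definition ad_vect {L : R} (u v : circle_fun L) : circle_fun L :=
  opp (minus (cf_mult u (cf_deriv v)) (cf_mult v (cf_deriv u))).

Definition gelfand_fuchs {L : R} (u v : circle_fun L) : R :=
  RInt (fun x => Derive u x * Derive_n v 2 x) 0 L.

(* Vect(S^1) + R, central coordinate second *)
Definition vir (L : R) : ModuleSpace R_AbsRing :=
  prod_ModuleSpace R_AbsRing (cf_ModuleSpace L) R_ModuleSpace.

Definition ad_vir {L : R} (X Y : vir L) : vir L :=
  (ad_vect (fst X) (fst Y), gelfand_fuchs (fst X) (fst Y)).

Definition ad_self_semidirect {A : AbelianGroup} (ad : A -> A -> A)
    (XY ZW : A * A) : A * A :=
  let (X, Y) := XY in
  let (Z, W) := ZW in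
  (ad X Z, minus (ad (plus X Y) (plus Z W)) (ad X Z)).

(* elements (u,a,v,b) are written ((u, a), (v, b)) *)
Definition vir_sd (L : R) : ModuleSpace R_AbsRing :=
  prod_ModuleSpace R_AbsRing (vir L) (vir L).

Definition ad_vir_sd {L : R} : vir_sd L -> vir_sd L -> vir_sd L :=
  ad_self_semidirect ad_vir.

(** ** Smooth dual, coadjoint operator, Euler-Poincare equation *)

(* elements (m,l,n,o) are written ((m, l), (n, o)); m and n are the coefficients
   of the quadratic differentials m dx(x)dx and n dx(x)dx *)
Definition vir_sd_dual (L : R) : ModuleSpace R_AbsRing :=
  prod_ModuleSpace R_AbsRing
    (prod_ModuleSpace R_AbsRing (cf_ModuleSpace L) R_ModuleSpace)
    (prod_ModuleSpace R_AbsRing (cf_ModuleSpace L) R_ModuleSpace).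

Definition pairing {L : R} (mu : vir_sd_dual L) (zeta : vir_sd L) : R :=
  let '((m, l), (n, o)) := mu in
  let '((u, a), (v, b)) := zeta in
  RInt (fun x => cf_fun m x * cf_fun u x + cf_fun n x * cf_fun v x) 0 L
  + l * a + o * b.

(* kappa = ad^*_zeta mu *)
Definition is_coad {L : R} (zeta : vir_sd L) (mu kappa : vir_sd_dual L) : Prop :=
  forall eta : vir_sd L, pairing kappa eta = pairing mu (ad_vir_sd zeta eta).

(* mu = delta ell / delta zeta, at the point zeta *)
Definition is_variational_derivative {L : R} (ell : vir_sd L -> R)
    (zeta : vir_sd L) (mu : vir_sd_dual L) : Prop :=
  forall eta : vir_sd L,
    is_derive (fun eps : R => ell (plus zeta (scal eps eta))) 0 (pairing mu eta).

(* Time runs over an open interval, possibly unbounded. *)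
Definition in_interval (t0 t1 : Rbar) (t : R) : Prop :=
  Rbar_lt t0 t /\ Rbar_lt t t1.

(* A curve in C^oo(S^1) is smooth iff it is jointly smooth in (t, x). *)
Definition smooth_curve {L : R} (t0 t1 : Rbar) (zeta : R -> vir_sd L) : Prop :=
  forall t, in_interval t0 t1 t -> forall k : nat,
    (forall x : R,
       ex_diff_n (fun s y => cf_fun (fst (fst (zeta s))) y) k t x
       /\ ex_diff_n (fun s y => cf_fun (fst (snd (zeta s))) y) k t x)
    /\ ex_derive_n (fun s => snd (fst (zeta s))) k t
    /\ ex_derive_n (fun s => snd (snd (zeta s))) k t.

(* nu = d mu / dt at time t, each function component being differentiated at
   fixed x *)
Definition is_time_derivative {L : R} (mu : R -> vir_sd_dual L) (t : R)
    (nu : vir_sd_dual L) : Prop :=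
  (forall x : R,
     is_derive (fun s => cf_fun (fst (fst (mu s))) x) t (cf_fun (fst (fst nu)) x))
  /\ is_derive (fun s => snd (fst (mu s))) t (snd (fst nu))
  /\ (forall x : R,
     is_derive (fun s => cf_fun (fst (snd (mu s))) x) t (cf_fun (fst (snd nu)) x))
  /\ is_derive (fun s => snd (snd (mu s))) t (snd (snd nu)).

(* d mu / dt + ad^*_zeta mu = 0, both terms being elements of the smooth dual *)
Definition euler_poincare {L : R} (t0 t1 : Rbar)
    (zeta : R -> vir_sd L) (mu : R -> vir_sd_dual L) : Prop :=
  forall t, in_interval t0 t1 t ->
    exists dmu kappa : vir_sd_dual L,
      is_time_derivative mu t dmu
      /\ is_coad (zeta t) (mu t) kappa
      /\ plus dmu kappa = zero.

(* The system of evolution equations for (m,l,n,o); in each equation the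
   differentiability in t of the unknown is part of the assertion, since Derive
   is a total operator. *)
Definition vir_sd_system {L : R} (t0 t1 : Rbar)
    (u v m : R -> circle_fun L) (l : R -> R)
    (n : R -> circle_fun L) (o : R -> R) : Prop :=
  forall t, in_interval t0 t1 t ->
    (forall x : R,
       ex_derive (fun s => m s x) t
       /\ Derive (fun s => m s x) t
          + Derive (fun y => u t y * m t y) x + Derive (u t) x * m t x
          + l t * Derive_n (u t) 3 x
          + Derive (fun y => v t y * n t y) x + Derive (v t) x * n t x
          + o t * Derive_n (v t) 3 x = 0)
    /\ (ex_derive l t /\ Derive l t = 0)
    /\ (forall x : R,
       ex_derive (fun s => n s x) t
       /\ Derive (fun s => n s x) t
          + Derive (fun y => (u t y + v t y) * n t y) x
          + Derive (fun y => u t y + v t y) x * n t x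
          + o t * Derive_n (fun y => u t y + v t y) 3 x = 0)
    /\ (ex_derive o t /\ Derive o t = 0).

(* Main.v *)
(** Integration by parts on the circle gives the coadjoint operator of the Virasoro
    algebra, [ad^*_(u,a) (m,l) = ((u m)_x + u_x m + l u_xxx, 0)]. Unfolding the bracket
    of the self-semidirect product then yields
    [ad^*_(X,Y) (M,N) = (ad^*_X M + ad^*_Y N, ad^*_(X+Y) N)], and this is the only
    coadjoint vector because the [L^2] pairing is nondegenerate. The equations for
    [D] and [E] are the differences of those for [(m,l)] and [(n,o)]. *)

Require Import Defs.
From Stdlib Require Import Reals Lra.
From Coquelicot Require Import Coquelicot.
Open Scope R_scope.

(** * Integration over one period *)

Lemma cf_ex_derive {L} (f : circle_fun L) x : ex_derive f x.
Proof. apply smooth_ex_derive, cf_smooth. Qed.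

Lemma cf_continuous {L} (f : circle_fun L) x : continuous f x.
Proof. apply (ex_derive_continuous (V := R_NormedModule)), cf_ex_derive. Qed.

Lemma cf_ex_RInt {L} (f : circle_fun L) x y : ex_RInt f x y.
Proof.
apply (ex_RInt_continuous (V := R_CompleteNormedModule)).
intros z _; apply cf_continuous.
Qed.

Definition integral {L} (f : circle_fun L) : R := RInt f 0 L.

Lemma integral_plus {L} (f g : circle_fun L) :
  integral (cf_plus f g) = integral f + integral g.
Proof. apply (RInt_plus f g); apply cf_ex_RInt. Qed.

Lemma integral_scal {L} c (f : circle_fun L) :
  integral (cf_scal c f) = c * integral f.
Proof. apply (RInt_scal f); apply cf_ex_RInt. Qed.

(** Periodicity makes the two endpoint values cancel, so integration by parts on the circle has no
    boundary term. *)
Lemma integral_deriv {L} (f : circle_fun L) : integral (cf_deriv f) = 0.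
Proof.
unfold integral; simpl; rewrite RInt_Derive.
- replace (f L) with (f 0); [ring|].
  rewrite <- (cf_periodic f 0); f_equal; ring.
- intros; apply cf_ex_derive.
- intros x _; apply (cf_continuous (cf_deriv f)).
Qed.

(* The primitive [F] is nondecreasing, and [L]-periodic because its increment over
   a period is constant and vanishes at [0]; hence it is constant near each point. *)
Lemma integral_nonneg_eq_zero {L} (hL : 0 < L) (f : circle_fun L) :
  (forall x, 0 <= f x) -> integral f = 0 -> forall x, f x = 0.
Proof.
intros f_ge0 int0 x.
set (F := fun y => RInt f 0 y).
assert (dF : forall y, is_derive F y (f y)).
{ intros y; apply is_derive_RInt with 0.
  - apply filter_forall; intros z; apply (RInt_correct f), cf_ex_RInt.
  - apply cf_continuous. }
assert (dG : forall y, is_derive (fun z => F (z + L) - F z) y 0).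
{ intros y.
  replace 0 with (1 * f (y + L) - f y) by (rewrite cf_periodic; ring).
  apply (is_derive_minus (fun z => F (z + L)) F); [|apply dF].
  apply (is_derive_comp F (fun z => z + L)); [apply dF|].
  auto_derive; auto. }
assert (G0 : F (0 + L) - F 0 = 0).
{ unfold F; rewrite RInt_point, Rplus_0_l; fold (integral f); rewrite int0.
  unfold zero; simpl; ring. }
assert (F_periodic : forall y, F (y + L) = F y).
{ intros y.
  assert (F (y + L) - F y = F (0 + L) - F 0); [|lra].
  destruct (Rtotal_order y 0) as [H|[->|H]]; auto.
  - apply (eq_is_derive (fun z => F (z + L) - F z)); [intros z _; apply dG|exact H].
  - symmetry.
    apply (eq_is_derive (fun z => F (z + L) - F z)); [intros z _; apply dG|exact H]. }
assert (F_incr : forall y z, y <= z -> F y <= F z).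
{ intros y z H.
  assert (C := RInt_Chasles f 0 y z (cf_ex_RInt f 0 y) (cf_ex_RInt f y z)).
  assert (P := RInt_ge_0 f y z H (cf_ex_RInt f y z) (fun w _ => f_ge0 w)).
  unfold plus in C; simpl in C; unfold F; lra. }
rewrite <- (is_derive_unique _ _ _ (dF x)).
apply is_derive_unique.
apply is_derive_ext_loc with (fun _ => F x); [|apply @is_derive_const].
(* For [y] within distance [L] of [x], both [x <= y + L] and [y <= x + L] hold, so monotonicity and
   periodicity of [F] give both inequalities between [F x] and [F y]. *)
exists (mkposreal L hL); intros y Hy.
apply Rabs_def2 in Hy; unfold minus, plus, opp in Hy; simpl in Hy.
apply Rle_antisym.
- rewrite <- (F_periodic y); apply F_incr; lra.
- rewrite <- (F_periodic x); apply F_incr; lra.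
Qed.

(** * The pairing on one Virasoro factor and its nondegeneracy *)

Definition pairing_vir {L} (M X : vir L) : R :=
  integral (cf_mult (fst M) (fst X)) + snd M * snd X.

Lemma pairing_vir_plus_l {L} (M N X : vir L) :
  pairing_vir (plus M N) X = pairing_vir M X + pairing_vir N X.
Proof.
unfold pairing_vir.
replace (cf_mult (fst (plus M N)) (fst X))
  with (cf_plus (cf_mult (fst M) (fst X)) (cf_mult (fst N) (fst X))).
- rewrite integral_plus; unfold plus; simpl; unfold plus; simpl; ring.
- apply circle_fun_eq; intros x; simpl; ring.
Qed.

Lemma pairing_vir_plus_r {L} (M X Y : vir L) :
  pairing_vir M (plus X Y) = pairing_vir M X + pairing_vir M Y.
Proof.
unfold pairing_vir.
replace (cf_mult (fst M) (fst (plus X Y)))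
  with (cf_plus (cf_mult (fst M) (fst X)) (cf_mult (fst M) (fst Y))).
- rewrite integral_plus; unfold plus; simpl; unfold plus; simpl; ring.
- apply circle_fun_eq; intros x; simpl; ring.
Qed.

Lemma pairing_vir_opp_l {L} (M X : vir L) :
  pairing_vir (opp M) X = - pairing_vir M X.
Proof.
unfold pairing_vir.
replace (cf_mult (fst (opp M)) (fst X))
  with (cf_scal (-1) (cf_mult (fst M) (fst X))).
- rewrite integral_scal; unfold opp; simpl; unfold opp; simpl; ring.
- apply circle_fun_eq; intros x; simpl; ring.
Qed.

Lemma pairing_vir_opp_r {L} (M X : vir L) :
  pairing_vir M (opp X) = - pairing_vir M X.
Proof.
unfold pairing_vir.
replace (cf_mult (fst M) (fst (opp X)))
  with (cf_scal (-1) (cf_mult (fst M) (fst X))).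
- rewrite integral_scal; unfold opp; simpl; unfold opp; simpl; ring.
- apply circle_fun_eq; intros x; simpl; ring.
Qed.

(** The smooth dual has the same carrier as [vir L], so [M] can be tested on itself. The result is
    $\int m^2\,dx + l^2$, a sum of two nonnegative terms, each of which must then vanish. *)
Lemma pairing_vir_self_eq_zero {L} (hL : 0 < L) (M : vir L) :
  pairing_vir M M = 0 -> M = zero.
Proof.
destruct M as [m l]; unfold pairing_vir; simpl; intros H.
assert (int_ge0 : 0 <= integral (cf_mult m m)).
{ apply RInt_ge_0; [lra|apply cf_ex_RInt|intros x _; apply Rle_0_sqr]. }
assert (l_ge0 := Rle_0_sqr l); unfold Rsqr in l_ge0.
apply (f_equal2 (@pair (circle_fun L) R)).
- apply circle_fun_eq; intros x; simpl.
  apply Rsqr_0_uniq.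
  apply (integral_nonneg_eq_zero hL (cf_mult m m)); [|lra].
  intros y; apply Rle_0_sqr.
- apply Rsqr_0_uniq; unfold Rsqr; lra.
Qed.

(** Splitting the pairing into blocks reduces all later computations to a single Virasoro factor. *)
Lemma pairingE {L} (mu zeta : vir_sd L) :
  pairing mu zeta
  = pairing_vir (fst mu) (fst zeta) + pairing_vir (snd mu) (snd zeta).
Proof.
destruct mu as [[m l] [n o]], zeta as [[u a] [v b]].
unfold pairing, pairing_vir; simpl.
assert (H := integral_plus (cf_mult m u) (cf_mult n v)).
unfold integral in *; simpl in *; rewrite H; ring.
Qed.

(** * Coadjoint operators of the Virasoro algebra and of its self-semidirect product *)

Definition coad_vir {L} (X M : vir L) : vir L :=
  (cf_plus
     (cf_plus (cf_deriv (cf_mult (fst X) (fst M)))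
              (cf_mult (cf_deriv (fst X)) (fst M)))
     (cf_scal (snd M) (cf_deriv (cf_deriv (cf_deriv (fst X))))),
   0).

(** The integrands on the two sides differ by $(umw)_x + l\,(u_{xx}w - u_xw_x)_x$, where $w$ is the
    function component of [Y]. A single exact derivative thus does the work of all the integrations
    by parts. The central component of [coad_vir] is 0 because the bracket ignores the central
    coordinate of [Y]. *)
Lemma pairing_coad_vir {L} (X M Y : vir L) :
  pairing_vir (coad_vir X M) Y = pairing_vir M (ad_vir X Y).
Proof.
destruct X as [u a], M as [m l], Y as [w c]; unfold pairing_vir; simpl.
set (u1 := cf_deriv u); set (u2 := cf_deriv u1).
set (w1 := cf_deriv w); set (w2 := cf_deriv w1).
change (gelfand_fuchs u w) with (integral (cf_mult u1 w2)).
(* [total] is the primitive of the difference of the two integrands. *)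
set (total := cf_plus (cf_mult (cf_mult u m) w)
   (cf_scal l (cf_plus (cf_mult u2 w) (cf_scal (-1) (cf_mult u1 w1))))).
rewrite <- integral_scal, Rmult_0_l, Rplus_0_r, <- integral_plus.
(* The 0 added on the right is turned into the integral of [cf_deriv total], which leaves a
   pointwise identity between integrands. *)
rewrite <- (Rplus_0_r (integral (cf_plus (cf_mult m _) _))).
rewrite <- (integral_deriv total), <- integral_plus.
f_equal; apply circle_fun_eq; intros x.
assert (dtotal : Derive total x = Derive (cf_mult u m) x * w x + u x * m x * w1 x
   + l * (Derive u2 x * w x + u2 x * w1 x - (Derive u1 x * w1 x + u1 x * w2 x))).
{ apply is_derive_unique.
  assert (d : forall f : circle_fun L, is_derive f x (Derive f x))
    by (intros f; apply Derive_correct, cf_ex_derive).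
  assert (dmul : forall f g : circle_fun L, is_derive (cf_mult f g) x
      (Derive f x * g x + f x * Derive g x)).
  { intros f g; apply is_derive_Reals, derivable_pt_lim_mult;
      apply is_derive_Reals, d. }
  apply (is_derive_plus (cf_mult (cf_mult u m) w)); [apply dmul|].
  apply is_derive_scal.
  replace (_ - _) with ((Derive u2 x * w x + u2 x * w1 x)
    + -1 * (Derive u1 x * w1 x + u1 x * w2 x)) by ring.
  apply (is_derive_plus (cf_mult u2 w)); [apply dmul|].
  apply is_derive_scal, dmul. }
change (cf_deriv total x) with (Derive total x).
cbn [cf_plus cf_fun]; cbn [cf_deriv cf_fun]; rewrite dtotal.
unfold u2, u1, w2, w1; simpl; ring.
Qed.

Definition coad_vir_sd {L} (zeta mu : vir_sd L) : vir_sd L :=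
  (plus (coad_vir (fst zeta) (fst mu)) (coad_vir (snd zeta) (snd mu)),
   coad_vir (plus (fst zeta) (snd zeta)) (snd mu)).

Lemma coad_vir_plus_l {L} (X Y M : vir L) :
  coad_vir (plus X Y) M = plus (coad_vir X M) (coad_vir Y M).
Proof.
destruct X as [u a], Y as [v b], M as [m l].
apply (f_equal2 (@pair (circle_fun L) R)); simpl; [|unfold plus; simpl; ring].
assert (E : forall f g : circle_fun L,
   cf_deriv (cf_plus f g) = cf_plus (cf_deriv f) (cf_deriv g)).
{ intros f g; apply circle_fun_eq; intros x; simpl.
  apply Derive_plus; apply cf_ex_derive. }
change (plus u v) with (cf_plus u v).
replace (cf_mult (cf_plus u v) m) with (cf_plus (cf_mult u m) (cf_mult v m))
  by (apply circle_fun_eq; intros x; simpl; ring).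
rewrite !E; apply circle_fun_eq; intros x; simpl; ring.
Qed.

(** Collecting the terms in $Z$ gives $ad^*_X M + ad^*_{X+Y} N - ad^*_X N$, which linearity in the
    first argument collapses to $ad^*_X M + ad^*_Y N$. The terms in $W$ give $ad^*_{X+Y} N$. *)
Lemma coad_vir_sd_correct {L} (zeta mu : vir_sd L) :
  is_coad zeta mu (coad_vir_sd zeta mu).
Proof.
destruct zeta as [X Y], mu as [M N]; intros [Z W]; rewrite !pairingE.
change (pairing_vir (plus (coad_vir X M) (coad_vir Y N)) Z
        + pairing_vir (coad_vir (plus X Y) N) W
        = pairing_vir M (ad_vir X Z)
          + pairing_vir N (plus (ad_vir (plus X Y) (plus Z W)) (opp (ad_vir X Z)))).
rewrite !pairing_vir_plus_r, pairing_vir_opp_r, <- !pairing_coad_vir.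
rewrite !coad_vir_plus_l, !pairing_vir_plus_l, !pairing_vir_plus_r; ring.
Qed.

(** The Euler-Poincaré equation only asserts that some coadjoint vector exists; uniqueness allows it
    to be replaced by the explicit one. The difference of two candidates pairs to zero with
    everything, in particular with itself. *)
Lemma is_coad_unique {L} (hL : 0 < L) (zeta mu kappa kappa' : vir_sd L) :
  is_coad zeta mu kappa -> is_coad zeta mu kappa' -> kappa = kappa'.
Proof.
destruct kappa as [K1 K2], kappa' as [K1' K2']; intros H H'.
assert (E : forall eta, pairing (K1, K2) eta = pairing (K1', K2') eta)
  by (intros eta; rewrite (H eta), (H' eta); reflexivity).
assert (eq_of_pairing : forall K K' : vir L,
  (forall X, pairing_vir K X = pairing_vir K' X) -> K = K').
{ intros K K' EK; apply plus_reg_r with (opp K'); rewrite plus_opp_r.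
  assert (K0 : plus K (opp K') = zero); [|exact K0].
  apply (pairing_vir_self_eq_zero hL).
  rewrite pairing_vir_plus_l, pairing_vir_opp_l, EK; ring. }
assert (pairing0 : forall K : vir L, pairing_vir K zero = 0).
{ intros K; assert (P := pairing_vir_plus_r K zero zero).
  rewrite plus_zero_r in P; lra. }
(* Test vectors supported in one factor isolate the corresponding block of the pairing. *)
apply (f_equal2 (@pair (vir L) (vir L))); apply eq_of_pairing; intros X.
- generalize (E (X, zero)); rewrite !pairingE; cbn [fst snd]; rewrite !pairing0; lra.
- generalize (E (zero, X)); rewrite !pairingE; cbn [fst snd]; rewrite !pairing0; lra.
Qed.

(** * From the coadjoint formula to the evolution equations *)

Lemma Derive_n_3 f x : Derive_n f 3 x = Derive (Derive (Derive f)) x.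
Proof. reflexivity. Qed.

Theorem mainTheorem3
    (L : R) (hL : 0 < L)
    (ell : vir_sd L -> R)
    (t0 t1 : Rbar)
    (u : R -> circle_fun L) (a : R -> R) (v : R -> circle_fun L) (b : R -> R)
    (hzeta : smooth_curve t0 t1 (fun t => ((u t, a t), (v t, b t))))
    (m : R -> circle_fun L) (l : R -> R) (n : R -> circle_fun L) (o : R -> R)
    (hmu : forall t, in_interval t0 t1 t ->
       is_variational_derivative ell
         ((u t, a t), (v t, b t)) ((m t, l t), (n t, o t))) :
  (euler_poincare t0 t1
     (fun t => ((u t, a t), (v t, b t))) (fun t => ((m t, l t), (n t, o t)))
   <-> vir_sd_system t0 t1 u v m l n o)
  /\
  (vir_sd_system t0 t1 u v m l n o ->
   let D := fun t x => m t x - n t x in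
   let E := fun t => l t - o t in
   forall t, in_interval t0 t1 t -> forall x : R,
     (ex_derive (fun s => D s x) t
      /\ Derive (fun s => D s x) t
         + Derive (fun y => u t y * D t y) x + Derive (u t) x * D t x
         + E t * Derive_n (u t) 3 x = 0)
     /\
     (ex_derive (fun s => n s x) t
      /\ Derive (fun s => n s x) t
         + Derive (fun y => (u t y + v t y) * n t y) x
         + Derive (fun y => u t y + v t y) x * n t x
         + o t * Derive_n (fun y => u t y + v t y) 3 x = 0)).
Proof.
split; [split|].
- intros EP t ht.
  destruct (EP t ht) as [dmu [kappa [[Hm [Hl [Hn Ho]]] [Hk E]]]].
  rewrite (is_coad_unique hL _ _ _ _ Hk (coad_vir_sd_correct _ _)) in E.
  change (is_derive l t (snd (fst dmu))) in Hl.
  change (is_derive o t (snd (snd dmu))) in Ho.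
  simpl in Hm, Hn.
  (* The four components of [dmu] plus the explicit coadjoint vector are the left-hand sides of the
     four evolution equations. *)
  assert (Em := fun x => f_equal (fun k : vir_sd L => cf_fun (fst (fst k)) x) E).
  assert (El := f_equal (fun k : vir_sd L => snd (fst k)) E).
  assert (En := fun x => f_equal (fun k : vir_sd L => cf_fun (fst (snd k)) x) E).
  assert (Eo := f_equal (fun k : vir_sd L => snd (snd k)) E).
  unfold plus, zero in Em, El, En, Eo; simpl in Em, El, En, Eo.
  unfold plus, zero in El, Eo; simpl in El, Eo.
  split; [|split; [|split]].
  + intros x; split; [eexists; apply Hm|].
    rewrite (is_derive_unique _ _ _ (Hm x)), !Derive_n_3; simpl.
    rewrite <- (Em x); ring.
  + split; [eexists; apply Hl|].
    rewrite (is_derive_unique _ _ _ Hl); now rewrite !Rplus_0_r in El.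
  + intros x; split; [eexists; apply Hn|].
    rewrite (is_derive_unique _ _ _ (Hn x)), !Derive_n_3; simpl.
    rewrite <- (En x); ring.
  + split; [eexists; apply Ho|].
    rewrite (is_derive_unique _ _ _ Ho); now rewrite !Rplus_0_r in Eo.
- intros S t ht; destruct (S t ht) as [Hm [[xl Hl] [Hn [xo Ho]]]].
  set (kappa := coad_vir_sd ((u t, a t), (v t, b t)) ((m t, l t), (n t, o t))).
  (* The equation forces the time derivative to be [opp kappa]; the system states that the
     derivatives in time have exactly these values. *)
  exists (opp kappa), kappa; split; [|split].
  + unfold is_time_derivative; simpl; split; [|split; [|split]].
    * intros x; destruct (Hm x) as [xm Em].
      match goal with |- is_derive _ _ ?d =>
        replace d with (Derive (fun s => m s x) t) end.
      { now apply Derive_correct. }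
      rewrite !Derive_n_3 in Em; unfold opp; simpl; lra.
    * match goal with |- is_derive _ _ ?d => replace d with (Derive l t) end.
      { now apply Derive_correct. }
      rewrite Hl; unfold opp, plus; simpl; ring.
    * intros x; destruct (Hn x) as [xn En].
      match goal with |- is_derive _ _ ?d =>
        replace d with (Derive (fun s => n s x) t) end.
      { now apply Derive_correct. }
      rewrite !Derive_n_3 in En; unfold opp; simpl; lra.
    * match goal with |- is_derive _ _ ?d => replace d with (Derive o t) end.
      { now apply Derive_correct. }
      rewrite Ho; unfold opp; simpl; ring.
  + apply coad_vir_sd_correct.
  + apply @plus_opp_l.
- intros S D E t ht x; destruct (S t ht) as [Hm [_ [Hn _]]].
  destruct (Hm x) as [xm Em], (Hn x) as [xn En].
  split; [|now split].
  assert (d := fun f : circle_fun L => cf_ex_derive f x).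
  split; [now apply (ex_derive_minus (fun s => m s x))|].
  assert (dD : Derive (fun s => D s x) t
     = Derive (fun s => m s x) t - Derive (fun s => n s x) t)
    by now apply Derive_minus.
  assert (duD : Derive (fun y => u t y * D t y) x
     = Derive (u t) x * (m t x - n t x)
       + u t x * (Derive (m t) x - Derive (n t) x)).
  { unfold D; rewrite Derive_mult, Derive_minus; auto.
    now apply (ex_derive_minus (m t)). }
  assert (d3 : Derive_n (fun y => u t y + v t y) 3 x
     = Derive_n (u t) 3 x + Derive_n (v t) 3 x).
  { apply Derive_n_plus; apply filter_forall; intros; apply cf_smooth. }
  (* Once products and sums are differentiated, the equation for [D] is [Em] minus [En]: the terms
     $(vn)_x + v_xn + o\,v_{xxx}$ occur in both and cancel. *)
  rewrite dD, duD; rewrite d3 in En.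
  rewrite !Derive_mult in Em by auto.
  rewrite Derive_mult, !Derive_plus in En by (auto; now apply (ex_derive_plus (u t))).
  unfold D, E; lra.
Qed.
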